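(* Let $G$ be a planar graph with maximum degree $\Delta$ and let $H$ be a subgraph of $G$ with maximum degree $d$. Then any total-$(\Delta+d+6)$-coloring of $H$ in $G$ can be extended to a total-$(\Delta+d+6)$-coloring of $G$.
   Context: All graphs are simple. A total-$k$-coloring of a graph is an assignment of colors from $\{1,\dots,k\}$ to its vertices and edges such that adjacent vertices receive different colors, edges sharing an endpoint receive different colors, and no edge receives the same color as either of its endpoints. For a subgraph $H$ of $G$, a total-$k$-coloring $\varphi$ of $H$ is a total-$k$-coloring of $H$ in $G$ if, in addition, $\varphi(u)\neq\varphi(v)$ for all $u,v\in V(H)$ adjacent in $G$. Extending $\varphi$ to $G$ means finding a total-$k$-coloring of $G$ that agrees with $\varphi$ on all vertices and edges of $H$. *)

(* Defs.v *)
From Stdlib Require Import Reals.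
From mathcomp Require Import all_boot.
Set Implicit Arguments. Unset Strict Implicit. Unset Printing Implicit Defensive.

Definition simple_graph (T : finType) (e : rel T) : Prop :=
  (forall x, ~~ e x x) /\ (forall x y, e x y = e y x).

Definition degree (T : finType) (e : rel T) (x : T) : nat := #|[set y | e x y]|.
Definition max_degree (T : finType) (e : rel T) : nat := \max_(x : T) degree e x.

Definition subgraph (T : finType) (e : rel T) (VH : {set T}) (h : rel T) : Prop :=
  (forall x y, h x y -> [/\ x \in VH, y \in VH & e x y]) /\
  (forall x y, h x y = h y x).

(* Planarity: a drawing in R^2. Vertices are sent injectively to points; each
   edge xy is a simple arc (continuous, injective on [0,1]) from pos x to pos y,
   the same arc for both orientations; the interior of an arc contains no vertex
   and meets no other edge's arc. Arcs are required to be continuous maps on all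
   of R (harmless: any arc on [0,1] extends continuously by constants). *)
Definition in01 (t : R) : Prop := Rle 0 t /\ Rle t 1.
Definition in01o (t : R) : Prop := Rlt 0 t /\ Rlt t 1.

Definition planar (T : finType) (e : rel T) : Prop :=
  exists (pos : T -> R * R) (arc : T -> T -> R -> R * R),
    (forall x y, pos x = pos y -> x = y) /\
    (forall x y, e x y ->
       [/\ continuity (fun t => fst (arc x y t)) /\
           continuity (fun t => snd (arc x y t)),
           (forall s t, in01 s -> in01 t -> arc x y s = arc x y t -> s = t),
           arc x y R0 = pos x,
           arc x y R1 = pos y &
           (forall t, arc y x t = arc x y (Rminus 1 t))]) /\
    (forall x y z s, e x y -> in01o s -> arc x y s <> pos z) /\
    (forall x y u v s t, e x y -> e u v ->
       ~ ((u = x /\ v = y) \/ (u = y /\ v = x)) ->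
       in01o s -> in01 t -> arc x y s <> arc u v t).

Definition total_coloring_in (T : finType) (e : rel T) (V : {set T}) (h : rel T)
    (k : nat) (cv : T -> nat) (ce : T -> T -> nat) : Prop :=
  [/\ (forall x, x \in V -> 1 <= cv x <= k),
      (forall x y, h x y -> 1 <= ce x y <= k /\ ce x y = ce y x),
      (forall x y, x \in V -> y \in V -> e x y -> cv x <> cv y),
      (forall x y z, h x y -> h x z -> y <> z -> ce x y <> ce x z) &
      (forall x y, h x y -> ce x y <> cv x /\ ce x y <> cv y)].

Definition total_coloring (T : finType) (e : rel T) (k : nat)
    (cv : T -> nat) (ce : T -> T -> nat) : Prop :=
  total_coloring_in e [set: T] e k cv ce.

(* Main.v *)
Require Import Defs.
From Stdlib Require Import Reals ZArith Lia Lra Classical.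
From Coquelicot Require Compactness.
From mathcomp Require Import all_boot zify.
Set Implicit Arguments. Unset Strict Implicit. Unset Printing Implicit Defensive.

(* The uncolored vertices are colored greedily, since there are more than Delta
   colors. Then the edges outside H are colored one at a time: as long as some
   remain, planarity gives a remaining edge uv with at most 5 remaining edges at
   u, and at most 2 + (d + 4) + (Delta - 1) colors are forbidden for uv.

   This 5-degeneracy is extracted from the topological drawing as follows. Only
   the disjointness of the arcs of disjoint edges is used; by compactness these
   arcs are uniformly separated, so sampling and rounding them gives lattice
   paths. Such drawings survive contractions (concatenate paths), so Mader's
   proof that at least 3n - 5 edges force a K5 minor reduces everything to
   excluding a drawing of K5. For a point o and a lattice path, count modulo 2
   the crossings of the path with the vertical ray above o. For two disjoint
   edges, the four counts of an end of one against the path of the other add up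
   to the number of lexicographic inversions between their ends; summing this
   over the 15 pairs of disjoint edges of K5 every count occurs twice, whereas
   the inversions add up to an odd number (van Kampen's obstruction). *)

(** * Lattice paths and crossing parity *)

Definition point := (Z * Z)%type.

Definition step (p q : point) : bool :=
  ((Z.abs (p.1 - q.1) <=? 1) && (Z.abs (p.2 - q.2) <=? 1))%Z.

(** The threshold 3 leaves room for one step of each point: a coordinate difference of at least 3
    keeps its sign when both points move by at most 1. *)
Definition far (p q : point) : bool :=
  ((3 <=? Z.abs (p.1 - q.1)) || (3 <=? Z.abs (p.2 - q.2)))%Z.

(** Breaking ties by the second coordinate amounts to tilting the vertical rays infinitesimally, so
    that vertical alignment is not a degenerate case. *)
Definition lexlt (p q : point) : bool :=
  ((p.1 <? q.1) || (p.1 =? q.1) && (p.2 <? q.2))%Z.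

(** The height of [p] alone decides: if a step from [p] to [q] changes sides of a point [o] far from
    [p], then [p] and [q] are both above [o] or both below it. *)
Definition cross (o p q : point) : bool :=
  (lexlt p o (+) lexlt q o) && (o.2 <? p.2)%Z.

Fixpoint crossings (o p : point) (s : seq point) : nat :=
  if s is q :: s' then cross o p q + crossings o q s' else 0.

Lemma lexlt_total (p q : point) : p <> q -> lexlt q p = ~~ lexlt p q.
Proof.
case: p q => [x y] [u v]; rewrite /lexlt /= => neq.
have {neq} : (x <> u \/ y <> v)%Z by case: (Z.eq_dec x u) => ?; [right|left] => // ?; apply: neq; congr pair.
by case: (Z.ltb_spec x u); case: (Z.ltb_spec u x); case: (Z.eqb_spec x u);
  case: (Z.eqb_spec u x); case: (Z.ltb_spec y v); case: (Z.ltb_spec v y) => //=; lia.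
Qed.

Lemma lexlt_left (p q : point) : (p.1 < q.1)%Z -> lexlt p q = true.
Proof. by rewrite /lexlt => /Z.ltb_lt ->. Qed.

Lemma far_neq (p q : point) : far p q -> p <> q.
Proof. by move=> + eqpq; rewrite eqpq /far !Z.sub_diag. Qed.

(** If the steps are separated horizontally, neither crosses a ray of the other and the four
    comparisons agree. If vertically, only rays from the lower step can be crossed, and the crossing
    of each is the sum of two of the four comparisons, or of their negations, which cancel. *)
Lemma cross_square (p p' q q' : point) :
    step p p' -> step q q' -> far p q ->
  ~~ odd (cross q p p' + cross q' p p' + (cross p q q' + cross p' q q') +
          (lexlt q p + lexlt q' p + (lexlt q p' + lexlt q' p'))).
Proof.
suff sum: step p p' -> step q q' -> far p q ->
    cross q p p' (+) cross q' p p' (+) (cross p q q' (+) cross p' q q') =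
    lexlt q p (+) lexlt q' p (+) (lexlt q p' (+) lexlt q' p').
  by move=> pp' qq' pq; rewrite !oddD !oddb sum // addbb.
case: p p' q q' => [x y] [x' y'] [u v] [u' v'].
rewrite /step /far /= => /andP[/Z.leb_le sx /Z.leb_le sy] /andP[/Z.leb_le tx /Z.leb_le ty].
move=> /orP[]/Z.leb_le d.
  have [l|l] : (x - u <= -3 \/ 3 <= x - u)%Z by lia.
    by rewrite /cross !(lexlt_left (p := (x, y))) ?(lexlt_left (p := (x', y'))) ?[lexlt (u, v) _]lexlt_total
         ?[lexlt (u', v') _]lexlt_total ?lexlt_left /=; try (lia || by case=> *; lia).
  by rewrite /cross !(lexlt_left (p := (u, v))) ?(lexlt_left (p := (u', v'))) ?[lexlt (x, y) _]lexlt_total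
       ?[lexlt (x', y') _]lexlt_total ?lexlt_left /=; try (lia || by case=> *; lia).
have neq z w z' w' : (w <> w')%Z -> (z, w) <> (z', w') by move=> ? [].
rewrite /cross /=.
have [l|l] : (y - v <= -3 \/ 3 <= y - v)%Z by lia.
  have [-> ->] : (v <? y)%Z = false /\ (v' <? y)%Z = false by lia.
  have [-> ->] : (y <? v)%Z = true /\ (y' <? v)%Z = true by lia.
  by rewrite !andbF !andbT /= addbACA.
have [-> ->] : (v <? y)%Z = true /\ (v' <? y)%Z = true by lia.
have [-> ->] : (y <? v)%Z = false /\ (y' <? v)%Z = false by lia.
rewrite !andbF !andbT addbF.
rewrite (@lexlt_total (x, y) (u, v)) ?(@lexlt_total (x, y) (u', v')) ?(@lexlt_total (x', y') (u, v))
  ?(@lexlt_total (x', y') (u', v')); try (apply: neq; lia).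
by do 4 case: lexlt.
Qed.

Lemma even_cancel (m n a b : nat) :
  ~~ odd a -> ~~ odd b -> n + m.*2 = a + b -> ~~ odd n.
Proof.
by move=> /negPf ea /negPf eb /(congr1 odd); rewrite !oddD ea eb odd_double addbF => ->.
Qed.

(* Both [crossings_step] and [crossings_grid] add up [cross_square] over a grid
   of pairs of steps; the contributions of interior grid lines cancel mod 2. *)
Lemma crossings_step (p p' q : point) (s : seq point) :
    step p p' -> path step q s -> all (far p) (q :: s) ->
  ~~ odd (cross q p p' + cross (last q s) p p' +
          (crossings p q s + crossings p' q s) +
          (lexlt q p + lexlt (last q s) p + (lexlt q p' + lexlt (last q s) p'))).
Proof.
move=> pp'; elim: s q => [|r s IH] q /=.
  by rewrite addn0 !oddD !addbb.
move=> /andP[qr rs] /and3P[pq pr ps].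
have {IH}:= IH r rs; rewrite /= pr ps => /(_ isT) IH.
apply: even_cancel (cross r p p' + lexlt r p + lexlt r p') _ _ _ IH (cross_square pp' qr pq) _.
by do 20 (try move: (nat_of_bool _) => ?); lia.
Qed.

Lemma crossings_grid (p q : point) (r s : seq point) :
    path step p r -> path step q s -> allrel far (p :: r) (q :: s) ->
  ~~ odd (crossings q p r + crossings (last q s) p r +
          (crossings p q s + crossings (last p r) q s) +
          (lexlt q p + lexlt (last q s) p +
           (lexlt q (last p r) + lexlt (last q s) (last p r)))).
Proof.
move=> + qs; elim: r p => [|p' r IH] p.
  by move=> _ _ /=; rewrite !oddD !addbb.
move=> /= /andP[pp' p'r]; rewrite allrel_consl => /andP[ps rs].
apply: even_cancel (crossings p' q s + lexlt q p' + lexlt (last q s) p') _ _ _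
  (IH _ p'r rs) (crossings_step pp' qs ps) _.
by do 20 (try move: (nat_of_bool _) => ?); lia.
Qed.

(** * Weak lattice drawings and the van Kampen obstruction for K5 *)

(* Arcs of adjacent edges may meet, and [arc x y] is unrelated to [arc y x]. *)
Definition weak_drawing (T : finType) (e : rel T) (pos : T -> point)
    (arc : T -> T -> seq point) : Prop :=
  (forall x y, e x y -> path step (pos x) (arc x y) /\ last (pos x) (arc x y) = pos y) /\
  (forall x y u v, e x y -> e u v -> [disjoint [:: x; y] & [:: u; v]] ->
     allrel far (pos x :: arc x y) (pos u :: arc u v)).

Lemma weak_drawing_pair (T : finType) (e : rel T) pos arc (x y u v : T) :
    weak_drawing e pos arc -> e x y -> e u v -> uniq [:: x; y; u; v] ->
  ~~ odd (crossings (pos u) (pos x) (arc x y) + crossings (pos v) (pos x) (arc x y) +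
          (crossings (pos x) (pos u) (arc u v) + crossings (pos y) (pos u) (arc u v)) +
          (lexlt (pos u) (pos x) + lexlt (pos v) (pos x) +
           (lexlt (pos u) (pos y) + lexlt (pos v) (pos y)))).
Proof.
move=> [ends disj] xy uv.
rewrite -[uniq _]/(uniq ([:: x; y] ++ [:: u; v])) cat_uniq => /and3P[_ dis _].
have [xp xl] := ends _ _ xy; have [up ul] := ends _ _ uv.
have := crossings_grid xp up; rewrite xl ul; apply; apply: disj => //.
by rewrite disjoint_sym disjoint_has.
Qed.

Lemma weak_drawing_no_K5 (T : finType) (e : rel T) pos arc (f : 'I_5 -> T) :
    weak_drawing e pos arc -> injective f ->
  ~ (forall i j : 'I_5, i != j -> e (f i) (f j)).
Proof.
move=> wd injf K.
pose g n := f (inord n).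
pose L i j : nat := lexlt (pos (g i)) (pos (g j)).
pose N k i j := crossings (pos (g k)) (pos (g i)) (arc (g i) (g j)).
pose ok i j k l := all (gtn 5) [:: i; j; k; l] && uniq [:: i; j; k; l].
have gK i j k l : ok i j k l -> [/\ e (g i) (g j), e (g k) (g l) & uniq [:: g i; g j; g k; g l]].
  move=> /andP[/= /and5P[i5 j5 k5 l5 _] us].
  have {us}: uniq [:: inord i; inord j; inord k; inord l : 'I_5].
    have inordI a b : a < 5 -> b < 5 -> (inord a == inord b :> 'I_5) = (a == b).
      by move=> a5 b5; rewrite -(inj_eq val_inj) /= !inordK.
    by move: us; rewrite /= !inE !inordI.
  rewrite -(map_inj_uniq injf) => us; split => //; apply: K;
    move: us; rewrite (map_inj_uniq injf) /= !inE !negb_or.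
    by case/andP => /and3P[].
  by case/and4P.
have crossN i j k l : ok i j k l ->
    exists m, N k i j + N l i j + (N i k l + N j k l) + (L k i + L l i + (L k j + L l j)) = m + m.
  move=> /gK[ij kl us]; have := weak_drawing_pair wd ij kl us.
  set n := (X in odd X) => /even_halfK; rewrite -addnn => h.
  by exists n./2; exact: esym h.
(* The disjoint edges [i k] and [j l] have arcs far apart, hence distinct starting points. *)
have antisym i j k l : ok i k j l -> L i j + L j i = 1.
  move=> /gK[ik jl us].
  have ne : pos (g i) <> pos (g j).
    apply: far_neq.
    have := wd.2 _ _ _ _ ik jl; rewrite disjoint_has => far_ij.
    move: us; rewrite -[uniq _]/(uniq ([:: g i; g k] ++ [:: g j; g l])) cat_uniq => /and3P[_ + _].
    by rewrite has_sym => /far_ij; rewrite allrel_consl /= => /andP[/andP[]].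
  by rewrite /L (lexlt_total ne); case: lexlt.
(* The fifteen pairs of disjoint edges; each row splits the four vertices other than an omitted
   one. *)
have [? ?] := crossN 0 1 2 3 isT; have [? ?] := crossN 0 2 1 3 isT; have [? ?] := crossN 0 3 1 2 isT.
have [? ?] := crossN 0 1 2 4 isT; have [? ?] := crossN 0 2 1 4 isT; have [? ?] := crossN 0 4 1 2 isT.
have [? ?] := crossN 0 1 3 4 isT; have [? ?] := crossN 0 3 1 4 isT; have [? ?] := crossN 0 4 1 3 isT.
have [? ?] := crossN 0 2 3 4 isT; have [? ?] := crossN 0 3 2 4 isT; have [? ?] := crossN 0 4 2 3 isT.
have [? ?] := crossN 1 2 3 4 isT; have [? ?] := crossN 1 3 2 4 isT; have [? ?] := crossN 1 4 2 3 isT.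
have ? := antisym 0 1 2 3 isT; have ? := antisym 0 2 1 3 isT; have ? := antisym 0 3 1 2 isT.
have ? := antisym 0 4 1 2 isT; have ? := antisym 1 2 0 3 isT; have ? := antisym 1 3 0 2 isT.
have ? := antisym 1 4 0 2 isT; have ? := antisym 2 3 0 1 isT; have ? := antisym 2 4 0 1 isT.
have ? := antisym 3 4 0 1 isT.
clear crossN antisym gK; clearbody N L.
(* Each row has three terms [L i j] with [i < j]. Replacing them by [1 - L j i] makes every
   comparison occur six times modulo 2 and leaves the constant 15, which is odd. *)
lia.
Qed.

Lemma weak_drawing_sub (T : finType) (e e' : rel T) pos arc :
  subrel e' e -> weak_drawing e pos arc -> weak_drawing e' pos arc.
Proof.
move=> sub [ends disj]; split=> [x y /sub|x y u v /sub xy /sub uv]; first exact: ends.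
exact: disj.
Qed.

Lemma weak_drawing_clique (T : finType) (e : rel T) pos arc (K : {set T}) :
    weak_drawing e pos arc -> {in K &, forall x y, x != y -> e x y} -> #|K| <= 4.
Proof.
move=> wd cl; rewrite leqNgt; apply/negP => K5.
pose f (i : 'I_5) := enum_val (widen_ord K5 i) : T.
have injf : injective f.
  by move=> i j /enum_val_inj /(congr1 val) /= /val_inj.
apply: (weak_drawing_no_K5 wd injf) => i j ij.
by apply: cl; rewrite ?enum_valP ?(inj_eq injf).
Qed.

(** * Contraction and deletion of edges *)

(* The edge [x y] is contracted to [x], which leaves [y] isolated. *)
Definition contract (T : finType) (e : rel T) (x y : T) : rel T := fun u v =>
  [&& u != y, v != y, u != v & e u v || [&& x \in [:: u; v], e u y & e y v]].

Lemma contract_sym (T : finType) (e : rel T) (x y : T) :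
  symmetric e -> symmetric (contract e x y).
Proof.
move=> sym u v; rewrite /contract (sym u v) (sym u y) (sym y v) (eq_sym u v) !inE.
by rewrite (orbC (x == u)) (andbC (e y u)) andbCA.
Qed.

(** A new edge ends at [x] and follows two old edges through [y]. An edge disjoint from it avoids
    [x], and also [y], which is isolated now; so it is an old edge disjoint from both pieces. In
    particular two disjoint edges are never both new. *)
Lemma weak_drawing_contract (T : finType) (e : rel T) pos arc (x y : T) :
    weak_drawing e pos arc ->
  weak_drawing (contract e x y) pos
    (fun u v => if e u v then arc u v else arc u y ++ arc y v).
Proof.
move=> [ends disj]; split=> [u v|].
  move=> /and4P[_ _ _]; case: ifP => [uv _|_ /=]; first exact: ends.
  move=> /and3P[_ /ends[uy ly] /ends[yv lv]].
  by rewrite cat_path last_cat uy ly yv.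
have disj2 u v a b : x \in [:: u; v] -> e u y -> e y v -> contract e x y a b ->
    [disjoint [:: u; v] & [:: a; b]] ->
    e a b /\ allrel far (pos u :: arc u y ++ arc y v) (pos a :: arc a b).
  move=> xuv uy yv /and4P[ay by' _ ab]; rewrite disjoint_has /= !orbF negb_or => /andP[ud vd].
  have {}ab : e a b.
    case/orP: ab => // /and3P[xab _ _].
    by move: xuv; rewrite !inE => /orP[]/eqP eq_x; rewrite -eq_x xab in ud vd.
  have yd : y \notin [:: a; b] by rewrite !inE negb_or eq_sym ay eq_sym by'.
  have d1 : [disjoint [:: u; y] & [:: a; b]] by rewrite disjoint_has /= (negPf ud) (negPf yd).
  have d2 : [disjoint [:: y; v] & [:: a; b]] by rewrite disjoint_has /= (negPf vd) (negPf yd).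
  split=> //; rewrite -cat_cons allrel_catl (disj _ _ _ _ uy ab d1) /=.
  by have := disj _ _ _ _ yv ab d2; rewrite allrel_consl => /andP[].
have far_sym : far =2 (fun p q => far q p).
  by move=> p q; rewrite /far -!(Z.abs_opp (p.1 - _)) -!(Z.abs_opp (p.2 - _)) !Z.opp_sub_distr !(Z.add_comm (- _)).
move=> u v a b uv ab dis; have dis' : [disjoint [:: a; b] & [:: u; v]] by rewrite disjoint_sym.
have /and4P[_ _ _ uv'] := uv; have /and4P[_ _ _ ab'] := ab.
case: ifP uv' => [euv _|neuv /= /and3P[xuv uy yv]].
  case: ifP ab' => [eab _|neab /= /and3P[xab ay yb]]; first exact: disj.
  rewrite allrelC -(eq_allrel far_sym).
  by have [_ ] := disj2 _ _ _ _ xab ay yb uv dis'.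
by have [eab ?] := disj2 _ _ _ _ xuv uy yv ab dis; rewrite eab.
Qed.

(** In terms of edges, a contraction loses [x y] itself and one of two parallel edges for each
    common neighbour; each lost edge counts twice in the degree sum. *)
Lemma degree_sum_contract (T : finType) (e : rel T) (x y : T) :
    symmetric e -> irreflexive e -> e x y ->
  \sum_u degree e u <=
  \sum_u degree (contract e x y) u + 2 * #|[set z | e x z && e y z]| + 2.
Proof.
move=> sym irr xy; set c := contract e x y; set Z := [set z | _].
have xny : x != y by apply: contraTneq xy => ->; rewrite irr.
have yx : e y x by rewrite sym.
have sum2 (F : T -> nat) : \sum_u F u = F x + F y + \sum_(u | (u != x) && (u != y)) F u.
  by rewrite (bigD1 x) //= (bigD1 y) ?(eq_sym y) //= addnA.
have degxy : degree e x + degree e y <= degree c x + #|Z| + 2.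
  rewrite /degree -cardsUI.
  have -> : [set z | e x z] :&: [set z | e y z] = Z by apply/setP => z; rewrite !inE.
  rewrite addnAC leq_add2r.
  apply: leq_trans (subset_leq_card _) (_ : #|[set z | c x z] :|: [set x; y]| <= _).
    apply/subsetP => z; rewrite !inE /c /contract xny inE eqxx xy /=.
    case: (eqVneq z x) => [->|zx]; first by rewrite orbT.
    case: (eqVneq z y) => [->|zy]; first by rewrite !orbT.
    by rewrite /= => ->.
  by rewrite (leq_trans (leq_card_setU _ _)) // leq_add2l cards2 xny.
have deg u : (u != x) && (u != y) -> degree e u <= degree c u + (u \in Z).
  move=> /andP[ux uy].
  have cux : e u y -> c u x.
    by move=> euy; rewrite /c /contract uy ux xny euy yx !inE eqxx !orbT.
  have cuz z : z != y -> e u z -> c u z.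
    move=> zy uz; rewrite /c /contract uy zy uz /= andbT.
    by apply: contraTneq uz => ->; rewrite irr.
  rewrite /degree !inE (sym x) (sym y); case uy': (e u y); last first.
    rewrite andbF addn0; apply: subset_leq_card; apply/subsetP => z; rewrite !inE => uz.
    by apply: cuz => //; apply: contraTneq uz => ->; rewrite uy'.
  rewrite andbT (cardsD1 y [set z | e u z]) inE uy' addnC.
  case ux': (e u x) => /=.
    rewrite leq_add2r; apply: subset_leq_card; apply/subsetP => z.
    by rewrite !inE => /andP[]; exact: cuz.
  have xN : x \notin [set z | e u z] :\ y by rewrite !inE ux' andbF.
  rewrite addn0 addnC; have := cardsU1 x ([set z | e u z] :\ y); rewrite xN => <-.
  apply: subset_leq_card; apply/subsetP => z; rewrite !inE => /orP[/eqP->|/andP[]].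
    exact: cux.
  exact: cuz.
rewrite !sum2; move: (leq_sum (index_enum T) deg) degxy; rewrite big_split /=.
have : \sum_(u | (u != x) && (u != y)) (u \in Z) <= #|Z|.
  rewrite -sum1_card [leqRHS]big_mkcond /= big_mkcond /=; apply: leq_sum => u _.
  by case: ifP => // _; case: (u \in Z).
lia.
Qed.

Definition delete_edge (T : finType) (e : rel T) (x y : T) : rel T := fun u v =>
  e u v && ~~ ((u == x) && (v == y) || (u == y) && (v == x)).

Lemma delete_edge_sym (T : finType) (e : rel T) (x y : T) :
  symmetric e -> symmetric (delete_edge e x y).
Proof.
by move=> sym u v; rewrite /delete_edge sym orbC (andbC (u == x)) (andbC (u == y)).
Qed.

Lemma delete_edge_sub (T : finType) (e : rel T) (x y : T) : subrel (delete_edge e x y) e.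
Proof. by move=> u v /andP[]. Qed.

Lemma degree_sub (T : finType) (e e' : rel T) (x : T) :
  subrel e' e -> degree e' x <= degree e x.
Proof. by move=> sub; apply: subset_leq_card; apply/subsetP => z; rewrite !inE; apply: sub. Qed.

Lemma degree_delete_edge (T : finType) (e : rel T) (x y : T) :
  e x y -> degree (delete_edge e x y) x < degree e x.
Proof.
move=> xy; apply: proper_card; apply/properP; split.
  by apply/subsetP => z; rewrite !inE; apply: delete_edge_sub.
by exists y; rewrite !inE // /delete_edge !eqxx andbF.
Qed.

Lemma degree_sum_delete_edge (T : finType) (e : rel T) (x y : T) :
  e x y -> \sum_u degree (delete_edge e x y) u < \sum_u degree e u.
Proof.
move=> xy; rewrite (bigD1 x) //= [ltnRHS](bigD1 x) //= -addSn.
apply: leq_add; first exact: degree_delete_edge.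
by apply: leq_sum => u _; apply/degree_sub/delete_edge_sub.
Qed.

(** * Mader's edge bound and 5-degeneracy *)

(** One deletion lowers the degree sum by at most two, so it cannot jump over the window from [m] to
    [m.+1]. The upper bound will force a vertex of small degree. *)
Lemma thin_graph (T : finType) (e : rel T) (m : nat) :
    symmetric e -> m <= \sum_u degree e u ->
  exists2 e' : rel T, symmetric e' /\ subrel e' e & m <= \sum_u degree e' u <= m.+1.
Proof.
have [n] := ubnP (\sum_u degree e u); elim: n => // n IH in e * => lt_n sym me.
case: (leqP (\sum_u degree e u) m.+1) => [le|gt]; first by exists e; [split|apply/andP; split].
have [x /existsP[y xy]] : exists x, [exists y, e x y].
  apply/existsP; apply: contraTT gt; rewrite negb_exists -leqNgt => /forallP no.
  rewrite big1 // => x _; apply/eqP; rewrite cards_eq0; apply/eqP/setP => y; rewrite !inE.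
  by have := no x; rewrite negb_exists => /forallP /(_ y) /negPf.
pose e1 := delete_edge e x y.
have deg u : degree e u <= degree e1 u + ((u == x) + (u == y)).
  have sub : [set z | e u z] \subset
      [set z | e1 u z] :|: ([set z | (u == x) && (z == y)] :|: [set z | (u == y) && (z == x)]).
    by apply/subsetP => z; rewrite !inE /e1 /delete_edge => ->; rewrite orNb.
  apply: leq_trans (subset_leq_card sub) _; apply: leq_trans (leq_card_setU _ _) _.
  rewrite leq_add2l; apply: leq_trans (leq_card_setU _ _) _.
  have one a b : #|[set z | (u == a) && (z == b)]| <= (u == a).
    case: (u == a); last by rewrite leqn0 cards_eq0; apply/eqP/setP => z; rewrite !inE.
    by rewrite (_ : [set z | _] = [set b]) ?cards1 //; apply/setP => z; rewrite !inE.
  exact: leq_add.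
have sum1x z : \sum_u (u == z) = 1.
  by rewrite (bigD1 z) //= eqxx big1 // => i /negPf ->.
have lower : \sum_u degree e u <= \sum_u degree e1 u + 2.
  by apply: leq_trans (leq_sum (index_enum T) (fun u _ => deg u)) _; rewrite !big_split /= !sum1x.
have upper : \sum_u degree e1 u < \sum_u degree e u by apply: degree_sum_delete_edge.
have [||e' [sym' sub'] bounds] := IH e1 _ (delete_edge_sym x y sym); [lia|lia|].
by exists e' => //; split=> // u v /sub' /delete_edge_sub.
Qed.

(* Mader's argument for graphs without a K5 minor: the neighbourhood of a vertex
   of degree at most 5 whose edges all lie in three triangles is a clique, or
   misses one or two disjoint pairs and then contains a K4 minor. *)
Lemma weak_drawing_link (T : finType) (e : rel T) pos arc (v : T) :
    symmetric e -> irreflexive e -> weak_drawing e pos arc -> 0 < degree e v <= 5 ->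
  exists2 u, e v u & #|[set z | e v z && e u z]| <= 2.
Proof.
move=> sym irr wd /andP[dv0 dv5].
apply/exists_inP; apply: contraLR isT; rewrite negb_exists_in => /forall_inP tri.
pose N := [set z | e v z].
have {tri} tri u : u \in N -> 3 <= #|N :&: [set z | e u z]|.
  rewrite inE => /tri; rewrite -ltnNge; congr (_ < #|pred_of_set _|).
  by apply/setP => z; rewrite !inE.
have vN : v \notin N by rewrite inE irr.
have N4 : 4 <= #|N|.
  have [u uN] := card_gt0P dv0; rewrite (cardsD1 u) uN ltnS (leq_trans (tri u uN)) //.
  apply: subset_leq_card; apply/subsetP => z; rewrite !inE => /andP[-> uz].
  by rewrite andbT; apply: contraTneq uz => ->; rewrite irr.
have [cl|] := boolP [forall x in N, forall y in N, (x != y) ==> e x y].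
  suff: #|v |: N| <= 4 by rewrite cardsU1 vN leqNgt ltnS N4.
  apply: weak_drawing_clique wd _ => x y.
  move=> /setU1P[->|xN] /setU1P[->|yN]; rewrite ?eqxx // => xy.
  - by move: yN; rewrite inE.
  - by move: xN; rewrite inE sym.
  by have /forall_inP/(_ _ xN)/forall_inP/(_ _ yN)/implyP := cl; apply.
rewrite negb_forall_in => /exists_inP[a aN]; rewrite negb_forall_in => /exists_inP[b bN].
rewrite negb_imply => /andP[ab nab].
(* Three neighbours inside [N] besides the two nonadjacent vertices force [#|N| = 5] and leave no
   further nonneighbour: the missing pairs in [N] form a matching. *)
have non x y : x \in N -> y \in N -> x != y -> ~~ e x y ->
    #|N| = 5 /\ {in N, forall z, z != x -> z != y -> e x z}.
  move=> xN yN xy nxy.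
  have sub : N :&: [set z | e x z] \subset N :\ x :\ y.
    apply/subsetP => z; rewrite !inE => /andP[-> xz]; rewrite andbT.
    by apply/andP; split; apply: contraTneq xz => ->; rewrite ?irr.
  have card2 : #|N| = 2 + #|N :\ x :\ y|.
    by rewrite (cardsD1 x) xN (cardsD1 y (N :\ x)) in_setD1 eq_sym xy yN.
  have le3 : #|N :\ x :\ y| <= 3 by rewrite -(leq_add2l 2) -card2.
  have eqN : N :&: [set z | e x z] = N :\ x :\ y.
    by apply/eqP; rewrite eqEcard sub (leq_trans le3) ?tri.
  split=> [|z zN zx zy].
    by apply/eqP; rewrite eqn_leq dv5 card2 -eqN ltnS ltnS tri.
  have : z \in N :\ x :\ y by rewrite !in_setD1 zy zx.
  by rewrite -eqN !inE => /andP[].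
have [card5 adja] := non a b aN bN ab nab.
have [_ adjb] : #|N| = 5 /\ {in N, forall z, z != b -> z != a -> e b z}.
  by apply: non => //; rewrite 1?eq_sym // sym.
(* If the other three neighbours are pairwise adjacent, they form a K5 with [v] and [a]. *)
pose R := N :\ a :\ b.
have cardR : #|R| = 3.
  have := cardsD1 a N; rewrite aN (cardsD1 b (N :\ a)) in_setD1 eq_sym ab bN card5.
  by move=> -[].
have RP z : z \in R -> [/\ z \in N, z != a & z != b] by rewrite !in_setD1 => /and3P[].
have [cl|] := boolP [forall x in R, forall y in R, (x != y) ==> e x y].
  suff: #|v |: (a |: R)| <= 4.
    have va : v != a by apply: contraNneq vN => ->.
    by rewrite !cardsU1 cardR !inE irr eqxx (negPf va) !andbF.
  apply: weak_drawing_clique wd _ => x y.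
  have sub : a |: R \subset N by apply/subsetP => z /setU1P[->|/RP[]].
  move=> /setU1P[->|xR] /setU1P[->|yR]; rewrite ?eqxx // => xy.
  - by have := subsetP sub _ yR; rewrite inE.
  - by have := subsetP sub _ xR; rewrite inE sym.
  move: xR yR => /setU1P[eqx|xR] /setU1P[eqy|yR].
  - by rewrite eqx eqy eqxx in xy.
  - by have [yN ya yb] := RP _ yR; rewrite eqx adja.
  - by have [xN xa xb] := RP _ xR; rewrite eqy sym adja.
  by have /forall_inP/(_ _ xR)/forall_inP/(_ _ yR)/implyP := cl; apply.
rewrite negb_forall_in => /exists_inP[c cR]; rewrite negb_forall_in => /exists_inP[d dR].
rewrite negb_imply => /andP[cd ncd].
have [cN ca cb] := RP _ cR; have [dN da db] := RP _ dR.
have [_ adjc] := non c d cN dN cd ncd.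
have [_ adjd] : #|N| = 5 /\ {in N, forall z, z != d -> z != c -> e d z}.
  by apply: non => //; rewrite 1?eq_sym // sym.
(* The missing pairs are [a b] and [c d]. Contracting [a c] joins [a] to [b] through [c] and removes
   [c], so [v] and the four remaining neighbours become a K5. *)
suff: #|v |: (N :\ c)| <= 4.
  by rewrite cardsU1 !inE irr andbF /=; move: card5; rewrite (cardsD1 c) cN add1n => -[->].
have wdc := weak_drawing_contract a c wd.
apply: (weak_drawing_clique wdc) => x y.
have vc : v != c by apply: contraNneq vN => ->.
have old z w : z != c -> w != c -> z != w -> e z w -> contract e a c z w.
  by rewrite /contract => -> -> -> ->.
have ac : e a c by apply: adja.
have new z : z != c -> a != z -> e c z -> contract e a c a z.
  by move=> zc az cz; rewrite /contract eq_sym ca zc az inE eqxx ac cz orbT.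
have symc := contract_sym a c sym.
have adjA z : z \in N -> z != c -> z != a -> contract e a c a z.
  move=> zN zc za; have [->|zb] := eqVneq z b; last by apply: old; rewrite ?adja // eq_sym.
  by apply: new; rewrite ?adjc // eq_sym.
have adjB z : z \in N -> z != c -> z != b -> contract e a c b z.
  move=> zN zc zb; have [->|za] := eqVneq z a; first by rewrite symc adjA // eq_sym.
  by apply: old; rewrite ?adjb // eq_sym.
have adjD z : z \in N -> z != c -> z != d -> contract e a c d z.
  by move=> zN zc zd; apply: old; rewrite ?adjd // eq_sym.
move=> /setU1P[->|xN] /setU1P[->|yN]; rewrite ?eqxx // => xy.
- by move: yN; rewrite !inE => /andP[yc vy]; apply: old.
- by move: xN; rewrite !inE => /andP[xc vx]; apply: old => //; rewrite sym.
move: xN yN => /setD1P[xc xN] /setD1P[yc yN].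
have [xa|xa] := eqVneq x a; first by rewrite xa adjA // eq_sym -xa.
have [ya|ya] := eqVneq y a; first by rewrite ya symc adjA // -ya.
have [xb|xb] := eqVneq x b; first by rewrite xb adjB // eq_sym -xb.
have [yb|yb] := eqVneq y b; first by rewrite yb symc adjB // -yb.
have [xd|xd] := eqVneq x d; first by rewrite xd adjD // eq_sym -xd.
have [yd|yd] := eqVneq y d; first by rewrite yd symc adjD // -yd.
have : #|R :\ c :\ d| <= 1.
  have := cardsD1 c R; rewrite cR (cardsD1 d (R :\ c)) in_setD1 eq_sym cd dR cardR !add1n.
  by move=> -[<-].
move=> /card_le1_eqP/(_ x y); rewrite !in_setD1 xa ya xb yb xc yc xd yd xN yN.
by move=> /(_ isT isT) exy; rewrite exy eqxx in xy.
Qed.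

(** With [m] edges and [n] vertices this is [m <= 3n - 6]. The set [V] may contain isolated
    vertices, so that the induction can shrink it inside the fixed type [T]. *)
Lemma weak_drawing_sparse (T : finType) (V : {set T}) (e : rel T) pos arc :
    symmetric e -> irreflexive e -> (forall x y, e x y -> x \in V) ->
    weak_drawing e pos arc -> 3 <= #|V| ->
  \sum_u degree e u + 10 < 6 * #|V|.
Proof.
have [n] := ubnP #|V|; elim: n => // n IH in V e arc *; rewrite ltnS => ltV.
move=> sym irr supp wd V3; rewrite ltnNge; apply/negP => dense.
have dense' : 6 * #|V| - 10 <= \sum_u degree e u by rewrite leq_subLR addnC.
have [e1 [sym1 sub1] /andP[lo hi]] := thin_graph sym dense'.
have irr1 : irreflexive e1 by move=> x; apply: contraFF (irr x) => /sub1.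
have supp1 x y : e1 x y -> x \in V by move=> /sub1 /supp.
have wd1 := weak_drawing_sub sub1 wd.
clear dense dense' sym irr supp wd sub1.
have sumV : \sum_u degree e1 u = \sum_(u in V) degree e1 u.
  rewrite [RHS]big_mkcond; apply: eq_bigr => u _; case: ifPn => // uV.
  by apply/eqP; rewrite cards_eq0; apply/eqP/setP => z; rewrite !inE; apply: contraNF uV => /supp1.
(* Three vertices have degree sum at most 6, below [6 * 3 - 10]. *)
have V4 : 4 <= #|V|.
  rewrite ltn_neqAle V3 andbT; apply/eqP => eqV.
  have : \sum_(u in V) degree e1 u <= \sum_(u in V) 2.
    apply: leq_sum => u uV; rewrite -ltnS eqV; apply: proper_card; apply/properP; split.
      by apply/subsetP => z; rewrite inE sym1 => /supp1.
    by exists u; rewrite ?inE ?irr1.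
  by rewrite -sumV sum_nat_const -eqV; lia.
have [v vV v5] : exists2 v, v \in V & degree e1 v <= 5.
  apply/exists_inP; apply: contraLR (leqnn 0); rewrite negb_exists_in => /forall_inP big.
  have : \sum_(u in V) 6 <= \sum_(u in V) degree e1 u.
    by apply: leq_sum => u /big; rewrite -ltnNge.
  by rewrite -sumV sum_nat_const; lia.
have card1 y : y \in V -> #|V| = #|V :\ y|.+1 by move=> yV; rewrite (cardsD1 y) yV.
have [v0|v0] := posnP (degree e1 v).
  have := IH (V :\ v) e1 arc _ sym1 irr1 _ wd1 _; have := card1 _ vV.
  suff supp' x y : e1 x y -> x \in V :\ v.
    by move=> cV /(_ _ supp' _); lia.
  move=> xy; rewrite in_setD1 (supp1 _ _ xy) andbT; apply: contraTneq xy => ->.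
  by have := cards0_eq v0 => /setP/(_ y); rewrite !inE => ->.
have [|y vy few] := weak_drawing_link sym1 irr1 wd1 (v := v); first by rewrite v0.
have yV : y \in V by rewrite sym1 in vy; apply: supp1 vy.
have sumc := degree_sum_contract sym1 irr1 vy.
have symc := contract_sym v y sym1.
have irrc : irreflexive (contract e1 v y) by move=> x; rewrite /contract eqxx !andbF.
have suppc a b : contract e1 v y a b -> a \in V :\ y.
  move=> /and4P[ay _ _ ab]; rewrite in_setD1 ay /=.
  by case/orP: ab => [/supp1|/and3P[_ /supp1]].
(* With at most two common neighbours the degree sum drops by at most [2 * 2 + 2 = 6], as does the
   bound for one vertex fewer. *)
have := IH (V :\ y) _ _ _ symc irrc suppc (weak_drawing_contract v y wd1) _.
by have := card1 _ yV; lia.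
Qed.

Lemma weak_drawing_degenerate (T : finType) (e : rel T) pos arc (x y : T) :
    symmetric e -> irreflexive e -> weak_drawing e pos arc -> e x y ->
  exists u v, e u v /\ degree e u <= 5.
Proof.
move=> sym irr wd xy.
suff /existsP[u /andP[/existsP[v uv] u5]] : [exists u, [exists v, e u v] && (degree e u <= 5)].
  by exists u, v.
apply: contraLR (leqnn 0); rewrite negb_exists => /forallP big.
pose V := [set u | [exists v, e u v]].
have supp a b : e a b -> a \in V by move=> ab; rewrite inE; apply/existsP; exists b.
have deg6 u : u \in V -> 6 <= degree e u.
  by have := big u; rewrite inE negb_and -ltnNge => /orP[/negPf->|].
have V6 : 6 <= #|V|.
  apply: leq_trans (deg6 _ (supp _ _ xy)) _; apply: subset_leq_card; apply/subsetP => z.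
  by rewrite inE sym => /supp.
have := weak_drawing_sparse sym irr supp wd (leq_trans _ V6).
have : \sum_(u in V) 6 <= \sum_u degree e u.
  by rewrite big_mkcond; apply: leq_sum => u _; case: ifP => // /deg6.
by rewrite sum_nat_const; lia.
Qed.

(** * From topological drawings to lattice drawings *)

Section Curves.

Local Open Scope R_scope.

Definition sup_dist (p q : R * R) : R := Rmax (Rabs (p.1 - q.1)) (Rabs (p.2 - q.2)).

Definition continuous_curve (A : R -> R * R) : Prop :=
  continuity (fun t => (A t).1) /\ continuity (fun t => (A t).2).

Lemma sup_dist_ge0 p q : (0 <= sup_dist p q).
Proof. by apply: Rle_trans (Rabs_pos _) (Rmax_l _ _). Qed.

Lemma sup_dist_gt0 p q : p <> q -> (0 < sup_dist p q).
Proof.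
case: p q => [a b] [c d] neq; case: (Rle_lt_or_eq_dec _ _ (sup_dist_ge0 (a, b) (c, d))) => // eq0.
have := Rmax_l (Rabs (a - c)) (Rabs (b - d)); have := Rmax_r (Rabs (a - c)) (Rabs (b - d)).
rewrite -[Rmax _ _]/(sup_dist (a, b) (c, d)) -eq0 => hb ha.
by case: neq; congr pair; move: ha hb; rewrite /Rabs; do 2 case: Rcase_abs; lra.
Qed.

Lemma sup_dist_triangle p q r : (sup_dist p r <= sup_dist p q + sup_dist q r).
Proof.
rewrite /sup_dist; apply: Rmax_lub.
  have := Rabs_triang (p.1 - q.1) (q.1 - r.1).
  rewrite (_ : (p.1 - q.1 + (q.1 - r.1) = p.1 - r.1)); last by ring.
  have := Rmax_l (Rabs (p.1 - q.1)) (Rabs (p.2 - q.2)).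
  have := Rmax_l (Rabs (q.1 - r.1)) (Rabs (q.2 - r.2)); lra.
have := Rabs_triang (p.2 - q.2) (q.2 - r.2).
rewrite (_ : (p.2 - q.2 + (q.2 - r.2) = p.2 - r.2)); last by ring.
have := Rmax_r (Rabs (p.1 - q.1)) (Rabs (p.2 - q.2)).
have := Rmax_r (Rabs (q.1 - r.1)) (Rabs (q.2 - r.2)); lra.
Qed.

Lemma sup_dist_sym p q : sup_dist p q = sup_dist q p.
Proof. by rewrite /sup_dist Rabs_minus_sym (Rabs_minus_sym (p.2)). Qed.

Lemma curve_modulus (A : R -> R * R) (eps : posreal) : continuous_curve A ->
  {delta : posreal | forall s t, in01 s -> in01 t -> (Rabs (s - t) < delta) ->
     (sup_dist (A s) (A t) < eps)}.
Proof.
move=> [c1 c2].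
have [d1 h1] := @Heine_cor2 _ 0 1 (fun x _ => c1 x) eps.
have [d2 h2] := @Heine_cor2 _ 0 1 (fun x _ => c2 x) eps.
have d0 : (0 < Rmin d1 d2) by apply: Rmin_pos; apply: cond_pos.
exists (mkposreal _ d0) => s t s01 t01 /= st.
apply: Rmax_lub_lt.
  by apply: h1 => //; apply: Rlt_le_trans st (Rmin_l _ _).
by apply: h2 => //; apply: Rlt_le_trans st (Rmin_r _ _).
Qed.

(** Continuity bounds the distance from below near each pair of parameters; compactness of the unit
    square makes the bound uniform. *)
Lemma curves_separated (A B : R -> R * R) :
    continuous_curve A -> continuous_curve B ->
    (forall s t, in01 s -> in01 t -> A s <> B t) ->
  exists2 d, (0 < d) & forall s t, in01 s -> in01 t -> (d <= sup_dist (A s) (B t)).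
Proof.
move=> cA cB disj.
have quarter s t : (0 < sup_dist (A s) (B t)) -> (0 < sup_dist (A s) (B t) / 4) by lra.
have modulus s t : {d : posreal | in01 s -> in01 t -> forall x y, in01 x -> in01 y ->
    (Rabs (x - s) < d -> Rabs (y - t) < d -> d <= sup_dist (A x) (B y))}.
  case: (Rlt_dec 0 (sup_dist (A s) (B t))) => [gt0|npos]; last first.
    (* Distance zero occurs only outside the square, where 1 is a dummy value. *)
    by exists (mkposreal 1 Rlt_0_1) => s01 t01; case: npos; apply/sup_dist_gt0/disj.
  (* Moving both points costs less than half of the distance [4 * eps], which leaves more than
     [eps]. *)
  have [eps epsE] : {eps : posreal | pos eps = sup_dist (A s) (B t) / 4}
    by exists (mkposreal _ (quarter _ _ gt0)).
  have [d1 h1] := curve_modulus eps cA; have [d2 h2] := curve_modulus eps cB.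
  have d0 : (0 < Rmin eps (Rmin d1 d2)) by repeat apply: Rmin_pos; apply: cond_pos.
  exists (mkposreal _ d0) => s01 t01 x y x01 y01 /= xs yt.
  have l1 := Rmin_l eps (Rmin d1 d2); have l2 := Rmin_r eps (Rmin d1 d2).
  have l3 := Rmin_l d1 d2; have l4 := Rmin_r d1 d2.
  have ax : (sup_dist (A x) (A s) < eps) by apply: h1 => //; lra.
  have bY : (sup_dist (B y) (B t) < eps) by apply: h2 => //; lra.
  have t1 := sup_dist_triangle (A s) (A x) (B t); have t2 := sup_dist_triangle (A x) (B y) (B t).
  rewrite sup_dist_sym in ax; lra.
have [d hd] := Compactness.compactness_value_2d 0 1 0 1 (fun s t => sval (modulus s t)).
exists d => [|x y x01 y01]; first exact: cond_pos.
have [s [t [s01 [t01 [xs [yt le]]]]]] := NNPP _ (hd _ _ x01 y01).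
apply: Rle_trans le _; exact: (svalP (modulus s t)).
Qed.

Definition round (M : R) (p : R * R) : point := (up (M * p.1), up (M * p.2)).

(** Applying [up] adds an amount in (0,1], so it changes a difference by less than 1; the same holds
    behind [up_far]. *)
Lemma up_close (x y : R) : (Rabs (x - y) < 1) -> (Z.abs (up x - up y) <= 1)%Z.
Proof.
have := archimed x; have := archimed y; move=> [? ?] [? ?] /Rabs_def2[? ?].
suff : (-2 < up x - up y < 2)%Z by lia.
by split; apply: lt_IZR; rewrite minus_IZR; lra.
Qed.

Lemma up_far (x y : R) : (4 <= Rabs (x - y)) -> (3 <= Z.abs (up x - up y))%Z.
Proof.
have := archimed x; have := archimed y; move=> [? ?] [? ?].
suff : (4 <= x - y -> (2 < up x - up y)%Z) /\ (4 <= y - x -> (2 < up y - up x)%Z).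
  by move=> [h1 h2]; rewrite /Rabs; case: Rcase_abs => ? ?; [have := h2 | have := h1]; lia || (move=> h; have := h ltac:(lra); lia).
by split=> ?; apply: lt_IZR; rewrite minus_IZR; lra.
Qed.

Lemma round_step (M : R) (p q : R * R) :
  0 < M -> M * sup_dist p q < 1 -> step (round M p) (round M q).
Proof.
move=> M0 close; rewrite /step /=.
have bound x y : Rabs (x - y) <= sup_dist p q -> (Z.abs (up (M * x) - up (M * y)) <= 1)%Z.
  move=> le; apply: up_close; rewrite -Rmult_minus_distr_l Rabs_mult Rabs_pos_eq; last lra.
  by apply: Rle_lt_trans close; apply: Rmult_le_compat_l => //; lra.
by apply/andP; split; apply/Z.leb_le/bound; [apply: Rmax_l|apply: Rmax_r].
Qed.

Lemma round_far (M : R) (p q : R * R) :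
  0 < M -> 4 <= M * sup_dist p q -> far (round M p) (round M q).
Proof.
move=> M0 apart; rewrite /far /=.
have bound x y : sup_dist p q = Rabs (x - y) -> (3 <= Z.abs (up (M * x) - up (M * y)))%Z.
  move=> eq_d; apply: up_far; rewrite -Rmult_minus_distr_l Rabs_mult Rabs_pos_eq -?eq_d //; lra.
apply/orP; have := bound p.1 q.1; have := bound p.2 q.2; rewrite /sup_dist /Rmax.
by case: Rle_dec => _ h2 h1; [right|left]; apply/Z.leb_le; [apply: h2|apply: h1].
Qed.

Lemma iota_path (g : nat -> point) (m n : nat) :
    (forall i, (m <= i < m + n)%N -> step (g i) (g i.+1)) ->
  path step (g m) [seq g i | i <- iota m.+1 n] /\
  last (g m) [seq g i | i <- iota m.+1 n] = g (m + n)%N.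
Proof.
elim: n m => [|n IH] m H; first by rewrite addn0.
have [|IHp IHl] := IH m.+1; first by move=> i Hi; apply: H; lia.
by rewrite /= IHp IHl addSnnS H //; lia.
Qed.

(** The curve is sampled at multiples of [1/N], with [1/N] below its modulus for [1/M]. Quantifying
    over [P] says that each path point is a rounded curve point, in the form that [allrel]
    consumes. *)
Lemma sample_curve (A : R -> R * R) (M : R) : continuous_curve A -> 0 < M ->
  exists s : seq point,
    [/\ path step (round M (A 0)) s, last (round M (A 0)) s = round M (A 1) &
      forall P : pred point, (forall t, in01 t -> P (round M (A t))) ->
        all P (round M (A 0) :: s)].
Proof.
move=> cA M0; have iM0 := Rinv_0_lt_compat _ M0.
have [d hd] := curve_modulus (mkposreal _ iM0) cA.
have [N [N0 hN]] : exists N, 0 < INR N /\ / INR N < d.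
  have [N [hN N0]] := archimed_cor1 d (cond_pos d).
  by exists N; split=> //; apply: lt_0_INR.
pose tm (i : nat) := INR i / INR N.
have tm01 i : (i <= N)%N -> in01 (tm i).
  move=> /leP /le_INR leN; have := pos_INR i => i0.
  split; first by apply: Rmult_le_pos => //; left; apply: Rinv_0_lt_compat.
  by apply: (Rmult_le_reg_r (INR N)) => //; rewrite /tm Rmult_assoc Rinv_l; lra.
have tm0 : tm 0%N = 0 by rewrite /tm /= /Rdiv Rmult_0_l.
have tmN : tm N = 1 by rewrite /tm /Rdiv Rinv_r //; lra.
pose g i := round M (A (tm i)).
have [|gp gl] := @iota_path g 0 N.
  move=> i /andP[_ iN]; apply: round_step => //.
  apply: (Rmult_lt_reg_l (/ M)) => //.
  rewrite -Rmult_assoc Rinv_l ?Rmult_1_l ?Rmult_1_r; last lra.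
  apply: hd; [by apply/tm01; lia|by apply: tm01|].
  rewrite (_ : tm i - tm i.+1 = - / INR N); last by rewrite /tm S_INR; field; lra.
  by rewrite Rabs_Ropp Rabs_pos_eq //; left; apply: Rinv_0_lt_compat.
exists [seq g i | i <- iota 1 N]; split.
- by move: gp; rewrite /g tm0.
- by move: gl; rewrite /g tm0 add0n tmN.
move=> P HP; have -> : round M (A 0) = g 0%N by rewrite /g tm0.
rewrite -[_ :: _]/[seq g i | i <- iota 0 N.+1] all_map; apply/allP => i.
by rewrite mem_iota => /andP[_ iN]; apply/HP/tm01.
Qed.

(** The last hypothesis covers interior points of the first arc. Two ends differ by injectivity of
    [pos]; an end against an interior point is the same hypothesis with the edges exchanged. *)
Lemma planar_arcs_disjoint (T : finType) (e : rel T) (pos : T -> R * R)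
    (arc : T -> T -> R -> R * R) :
    (forall x y, pos x = pos y -> x = y) ->
    (forall x y, e x y -> arc x y 0 = pos x /\ arc x y 1 = pos y) ->
    (forall x y u v s t, e x y -> e u v ->
       ~ ((u = x /\ v = y) \/ (u = y /\ v = x)) ->
       in01o s -> in01 t -> arc x y s <> arc u v t) ->
  forall x y u v s t, e x y -> e u v -> [disjoint [:: x; y] & [:: u; v]] ->
    in01 s -> in01 t -> arc x y s <> arc u v t.
Proof.
move=> inj ends cross x y u v s t xy uv.
rewrite disjoint_has /= !inE orbF !negb_or => /andP[/andP[/eqP xu /eqP xv] /andP[/eqP yu /eqP yv]] s01 t01.
have [ax ay] := ends _ _ xy; have [au av] := ends _ _ uv.
have trich r : in01 r -> [\/ r = 0, r = 1 | in01o r].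
  move=> [r0 r1]; case: (Req_dec r 0) => [|n0]; first by constructor 1.
  case: (Req_dec r 1) => [|n1]; first by constructor 2.
  by constructor 3; split; lra.
have [es|es|s01o] := trich s s01; last first.
- by apply: cross => // -[] [? _]; [apply: xu|apply: yu].
- have [et|et|t01o] := trich t t01; rewrite es ?et ?ay ?au ?av; try by move/inj.
  by rewrite -ay -es; apply: nesym; apply: cross => // -[] [? _]; [apply: xu|apply: xv].
have [et|et|t01o] := trich t t01; rewrite es ?et ?ax ?au ?av; try by move/inj.
by rewrite -ax -es; apply: nesym; apply: cross => // -[] [? _]; [apply: xu|apply: xv].
Qed.

Lemma planar_weak_drawing (T : finType) (e : rel T) :
  planar e -> exists pos arc, weak_drawing e pos arc.
Proof.
move=> [pos [arc [inj [arcP [_ cross]]]]].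
have cont x y : e x y -> continuous_curve (arc x y) by move=> /arcP[].
have ends x y : e x y -> arc x y 0 = pos x /\ arc x y 1 = pos y by move=> /arcP[].
have disj := planar_arcs_disjoint inj ends cross.
have sep (q : (T * T) * (T * T)) : exists m : nat, forall M, 0 < M -> INR m <= M ->
    e q.1.1 q.1.2 -> e q.2.1 q.2.2 -> [disjoint [:: q.1.1; q.1.2] & [:: q.2.1; q.2.2]] ->
    forall s t, in01 s -> in01 t -> far (round M (arc q.1.1 q.1.2 s)) (round M (arc q.2.1 q.2.2 t)).
  case: q => [[x y] [u v]] /=.
  case: (classic [/\ e x y, e u v & [disjoint [:: x; y] & [:: u; v]]]) => [[xy uv dis]|no]; last first.
    by exists 0%N => M _ _ xy uv dis; case: no.
  have [d d0 hd] := curves_separated (cont _ _ xy) (cont _ _ uv)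
    (fun s t => disj x y u v s t xy uv dis).
  have [m hm] := INR_unbounded (4 / d).
  exists m => M M0 mM _ _ _ s t s01 t01; apply: round_far => //.
  apply: Rle_trans (Rmult_le_compat_l _ _ _ _ (hd s t s01 t01)); last lra.
  apply: (Rmult_le_reg_r (/ d)); first exact: Rinv_0_lt_compat.
  rewrite Rmult_assoc Rinv_r; lra.
have [m hm] := fin_all_exists sep.
(* One scale for all pairs of edges; the successor keeps it positive. *)
pose M := INR (\max_q m q).+1.
have M0 : 0 < M by rewrite /M; apply: lt_0_INR; lia.
have leM q : INR (m q) <= M.
  by apply/le_INR/leP; rewrite ltnW // ltnS leq_bigmax.
have sample (p : T * T) : exists s : seq point, e p.1 p.2 ->
    [/\ path step (round M (pos p.1)) s, last (round M (pos p.1)) s = round M (pos p.2) &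
      forall P : pred point, (forall t, in01 t -> P (round M (arc p.1 p.2 t))) ->
        all P (round M (pos p.1) :: s)].
  case: p => x y /=; case xy: (e x y); last by exists [::].
  have [s] := sample_curve (cont _ _ xy) M0.
  by have [-> ->] := ends _ _ xy; exists s.
have [s hs] := fin_all_exists sample.
exists (fun x => round M (pos x)), (fun x y => s (x, y)); split.
  by move=> x y xy; have [] := hs (x, y) xy.
move=> x y u v xy uv dis.
have [_ _ hx] := hs (x, y) xy; have [_ _ hu] := hs (u, v) uv.
apply: hx => r r01; apply: hu => t t01.
exact: (hm ((x, y), (u, v))).
Qed.

End Curves.

(** * Extending the coloring *)

Lemma free_color (k : nat) (s : seq nat) :
  size s < k -> exists c, 1 <= c <= k /\ c \notin s.
Proof.
move=> lt_sk.
suff /hasP[c] : has (fun c => c \notin s) (iota 1 k).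
  by rewrite mem_iota add1n ltnS; exists c.
apply: contraLR lt_sk => /hasPn all_s; rewrite -leqNgt -(size_iota 1 k).
by apply: uniq_leq_size (iota_uniq _ _) _ => c /all_s; rewrite negbK.
Qed.

Lemma degree_le_max (T : finType) (e : rel T) (x : T) : degree e x <= max_degree e.
Proof. exact: (leq_bigmax x). Qed.

Lemma extend_vertex_coloring (T : finType) (e : rel T) (V : {set T}) (k : nat) (cv : T -> nat) :
    simple_graph e -> max_degree e < k -> (forall x, x \in V -> 1 <= cv x <= k) ->
    (forall x y, x \in V -> y \in V -> e x y -> cv x <> cv y) ->
  exists cv' : T -> nat,
    [/\ forall x, x \in V -> cv' x = cv x, forall x, 1 <= cv' x <= k &
        forall x y, e x y -> cv' x <> cv' y].
Proof.
move=> [irr sym] lt_k; have [n] := ubnP #|~: V|; elim: n => // n IH in V cv * => ltn rng prop.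
have [VT|] := eqVneq (~: V) set0.
  have inV x : x \in V by apply: contra_eqT VT => xV; apply/set0Pn; exists x; rewrite inE.
  by exists cv; split=> [//|x|x y]; [apply: rng|apply: prop].
case/set0Pn=> x xV; have nxV : x \notin V by rewrite inE in xV.
(* The values at all neighbours are avoided, even the arbitrary ones outside [V]: there are at most
   Delta of them. *)
have [|c [crng cfree]] := @free_color k [seq cv z | z in [set z | e x z]].
  by rewrite size_map -cardE (leq_ltn_trans (degree_le_max e x)).
have cN z : e x z -> cv z <> c.
  by move=> xz zc; case/negP: cfree; rewrite -zc; apply: image_f; rewrite inE.
pose cv1 z := if z == x then c else cv z.
have [||| cv' [ext rng' prop']] := IH (x |: V) cv1.
- by move: ltn; rewrite (cardsD1 x) xV setCU setDE setIC add1n ltnS.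
- by move=> z; rewrite /cv1 in_setU1; case: eqP => //= _; apply: rng.
- move=> y z; rewrite /cv1 !in_setU1; case: eqP => [->|_] /=; case: eqP => [->|_] //= yV zV yz.
  + by rewrite (negPf (irr x)) in yz.
  + by move=> zc; apply: (cN z yz).
  + by apply: cN; rewrite sym.
  exact: prop.
exists cv'; split=> // z zV; rewrite ext ?in_setU1 ?zV ?orbT // /cv1.
by case: eqP zV => // ->; rewrite (negPf nxV).
Qed.

(** Induction on [g], the graph whose edges receive colors: an edge outside [h] at a vertex of low
    degree in [g] minus [h] is removed first and colored last. *)
Lemma extend_edge_coloring (T : finType) (e h g : rel T) pos arc cv ce
    (k := max_degree e + max_degree h + 6) :
    simple_graph e -> weak_drawing e pos arc -> symmetric h -> symmetric g ->
    subrel h g -> subrel g e -> total_coloring_in e [set: T] h k cv ce ->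
  exists2 ce', total_coloring_in e [set: T] g k cv ce' &
    forall x y, h x y -> ce' x y = ce x y.
Proof.
move=> [irr sym] wd symh + + + col; have [n] := ubnP (\sum_u degree g u).
elim: n g => // n IH g ltn symg hg ge.
pose f : rel T := fun u v => g u v && ~~ h u v.
have fe : subrel f e by move=> u v /andP[/ge].
have symf : symmetric f by move=> u v; rewrite /f symg symh.
have irrf : irreflexive f by move=> u; apply: contraNF (irr u) => /fe.
have [/existsP[x /existsP[y xy]]|nof] := boolP [exists x, exists y, f x y]; last first.
  have gh : subrel g h.
    move=> u v uv; apply: contraNT nof => nuv.
    by apply/existsP; exists u; apply/existsP; exists v; rewrite /f uv.
  have [rngv rnge pv pe pve] := col.
  exists ce => //; split=> // [u v /gh /rnge //|u v w /gh uv /gh uw|u v /gh /pve //].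
  exact: pe.
have [u [v [uv u5]]] := weak_drawing_degenerate symf irrf (weak_drawing_sub fe wd) xy.
have [guv nhuv] := andP uv.
pose g1 := delete_edge g u v.
have [||||ce1 [rngv rnge pv pe pve] ext] := IH g1.
- exact: leq_trans (degree_sum_delete_edge guv) ltn.
- exact: delete_edge_sym.
- move=> a b hab; rewrite /g1 /delete_edge hg //=; apply: contra nhuv.
  by case/orP => /andP[/eqP <- /eqP <-]; rewrite // symh.
- by move=> a b /delete_edge_sub /ge.
pose used w := [seq ce1 w z | z in [set z | g1 w z]].
have sizeU w : size (used w) = degree g1 w by rewrite size_map -cardE.
(* Edges of [h] at [u], plus the at most 5 others without [u v] itself. *)
have degu : degree g1 u <= max_degree h + 4.
  apply: leq_trans (_ : degree h u + degree (delete_edge f u v) u <= _).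
    apply: leq_trans (leq_card_setU _ _); apply: subset_leq_card; apply/subsetP => z.
    by rewrite !inE /g1 /delete_edge /f => /andP[-> ->]; rewrite andbT orbN.
  by apply: leq_add (degree_le_max h u) _; rewrite -ltnS (leq_trans _ u5) // degree_delete_edge.
have degv : degree g1 v < max_degree e.
  apply: leq_trans (degree_le_max e v).
  have e1 : g1 =2 delete_edge g v u by move=> a b; rewrite /g1 /delete_edge orbC.
  rewrite (leq_ltn_trans (@degree_sub _ (delete_edge e v u) _ _ _)) ?degree_delete_edge //.
    by move=> a b; rewrite e1 => /andP[/ge ab]; rewrite /delete_edge ab.
  by rewrite sym fe.
(* At most [2 + (d + 4) + (Delta - 1) = k - 1] colors are forbidden. *)
have [|c [crng cfree]] := @free_color k [:: cv u, cv v & used u ++ used v].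
  by rewrite /= size_cat !sizeU /k; lia.
move: cfree; rewrite !inE mem_cat !negb_or => /and4P[/eqP cu /eqP cv' fu fv].
have freeu z : g1 u z -> c <> ce1 u z.
  by move=> uz cz; case/negP: fu; rewrite cz; apply: image_f; rewrite inE.
have freev z : g1 v z -> c <> ce1 v z.
  by move=> uz cz; case/negP: fv; rewrite cz; apply: image_f; rewrite inE.
pose new a b := (a == u) && (b == v) || (a == v) && (b == u).
have newC a b : new a b = new b a by rewrite /new orbC (andbC (a == v)) (andbC (a == u)).
have g1P a b : g a b -> new a b = false -> g1 a b by rewrite /g1 /delete_edge => -> /negbT.
have cfree w z z' : g w z -> g w z' -> z <> z' -> new w z -> c <> (if new w z' then c else ce1 w z').
  move=> wz wz' zz'; have [nwz'|nwz'] := boolP (new w z').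
    case/orP=> /andP[/eqP ew /eqP ez]; case/orP: nwz' => /andP[/eqP ew' /eqP ez'].
    - by case: zz'; rewrite ez ez'.
    - by have := irr u; rewrite -{1}ew ew' sym fe // uv.
    - by have := irr u; rewrite -{1}ew' ew sym fe // uv.
    by case: zz'; rewrite ez ez'.
  have := g1P _ _ wz' (negbTE nwz').
  by move=> wz1 /orP[/andP[/eqP ew _]|/andP[/eqP ew _]]; rewrite ew in wz1 *; [apply: freeu|apply: freev].
exists (fun a b => if new a b then c else ce1 a b); last first.
  move=> a b hab; rewrite -ext //; case: ifP => // /orP[] /andP[/eqP ea /eqP eb].
    by rewrite -ea -eb hab in nhuv.
  by rewrite -ea -eb symh hab in nhuv.
split=> // [a b ab|a b z ab az bz|a b ab].
- rewrite (newC b); case: ifPn => // nab; exact: rnge (g1P _ _ ab (negbTE nab)).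
- case: ifPn => [nab|nab]; first exact: cfree ab az bz nab.
  case: ifPn => [naz|naz].
    by have := cfree _ _ _ az ab (nesym bz) naz; rewrite (negPf nab) => /nesym.
  exact: pe (g1P _ _ ab (negbTE nab)) (g1P _ _ az (negbTE naz)) bz.
case: ifPn => [/orP[]/andP[/eqP-> /eqP->] //|nab]; exact: pve (g1P _ _ ab (negbTE nab)).
Qed.

Theorem theorem1p9 (T : finType) (e : rel T) (VH : {set T}) (h : rel T)
    (cv : T -> nat) (ce : T -> T -> nat) :
  simple_graph e -> planar e -> subgraph e VH h ->
  total_coloring_in e VH h (max_degree e + max_degree h + 6) cv ce ->
  exists (cv' : T -> nat) (ce' : T -> T -> nat),
    total_coloring e (max_degree e + max_degree h + 6) cv' ce' /\
    (forall x, x \in VH -> cv' x = cv x) /\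
    (forall x y, h x y -> ce' x y = ce x y).
Proof.
move=> simple /planar_weak_drawing[pos [arc wd]] [hP symh] [rngv rnge pv pe pve].
have [|cv' [ext rngv' pv']] := extend_vertex_coloring simple _ rngv pv; first by lia.
have he : subrel h e by move=> x y /hP[].
(* Ends of edges of [h] lie in [VH], where [cv'] agrees with [cv], so [ce] stays compatible. *)
have col : total_coloring_in e [set: T] h (max_degree e + max_degree h + 6) cv' ce.
  split=> // [x y _ _|x y xy]; first exact: pv'.
  by have [xV yV _] := hP _ _ xy; rewrite !ext //; apply: pve.
have [ce' col' exte] := extend_edge_coloring simple wd symh simple.2 he (fun _ _ xy => xy) col.
by exists cv', ce'.
Qed.
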